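(* Let $A,C\in\mathbb{R}^{n\times n}$, $B,D\in\mathbb{R}^{n\times m}$ and $\lambda\in\mathbb{C}$. Then $\lambda$ is an unremovable spectrum of the system $dx=(Ax+Bu)\,dt+(Cx+Du)\,dw$ with state feedback $u=Kx$ if and only if there exists $0\neq X\in\mathcal{S}_n$ such that the three equalities $$XA+A'X+C'XC=\lambda X,\qquad XB+C'XD=0,\qquad D'XD=0$$ hold.
   Context: $M'$ denotes the transpose of $M$. $\mathcal{S}_n$ is the set of all $n\times n$ symmetric matrices ($X=X'$), with entries allowed to be complex. $w$ is a standard one-dimensional Wiener process. Definition: $\lambda$ is an unremovable spectrum of the system $dx=(Ax+Bu)\,dt+(Cx+Du)\,dw$ with state feedback $u=Kx$ if there exists $0\ne X\in\mathcal{S}_n$ such that for every $K\in\mathbb{R}^{m\times n}$, $$X(A+BK)+(A+BK)'X+(C+DK)'X(C+DK)=\lambda X.$$ *)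

(* Defs.v *)
From mathcomp Require Import all_boot all_order all_algebra.
From mathcomp Require Import reals.
From mathcomp Require Export complex.
Set Implicit Arguments.
Unset Strict Implicit.
Unset Printing Implicit Defensive.
Import GRing.Theory.
Local Open Scope ring_scope.

Definition complexify (R : realType) (p q : nat) (M : 'M[R]_(p, q)) :
    'M[R[i]]_(p, q) :=
  map_mx (real_complex R) M.

(* Unremovable spectrum of dx = (A x + B u) dt + (C x + D u) dw under the state
   feedback u = K x; the closed loop is dx = (A + B K) x dt + (C + D K) x dw.
   The gain K is real while X and lambda are complex, and [^T] is the plain
   (not the conjugate) transpose.  A single X must serve every K. *)
Definition unremovable_spectrum (R : realType) (n m : nat)
    (A : 'M[R]_n) (B : 'M[R]_(n, m)) (C : 'M[R]_n) (D : 'M[R]_(n, m))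
    (lambda : R[i]) : Prop :=
  exists X : 'M[R[i]]_n,
    [/\ X != 0, X = X^T &
        forall K : 'M[R]_(m, n),
          let AK := complexify (A + B *m K) in
          let CK := complexify (C + D *m K) in
          X *m AK + AK^T *m X + CK^T *m X *m CK = lambda *: X].

(* Main.v *)
Require Import Defs.
From mathcomp Require Import all_boot all_order all_algebra.
From mathcomp Require Import reals.
Local Open Scope ring_scope.

(** For symmetric [X], the closed-loop operator is a polynomial of degree two
    in the gain [K]: with [N = X B + C' X D] and [P = D' X D],
      [X (A + B K) + (A + B K)' X + (C + D K)' X (C + D K)
         = (X A + A' X + C' X C) + (N K + (N K)' + K' P K)]
    ([closed_loop_expansion]).  If the three equalities hold, only the constant
    term [lambda X] remains.  Conversely [K = 0] identifies the constant term
    with [lambda X], so the bracket vanishes for every real [K], and the two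
    matrices [N] and [P] can be recovered from it.  Comparing [K] with [- K]
    separates the linear part from the quadratic one.  Matrix units substituted
    for [K] in the linear part give [2 N i j] as diagonal entries
    ([linear_part_eq0]); in the quadratic part, polarization gives
    [P j k + P k j], which is [2 P j k] since [P] is symmetric
    ([quadratic_part_eq0]).  Matrix units are real, so it does not matter that
    [K] is real while [N] and [P] are complex. *)

Import GRing.Theory Num.Theory.
Set Implicit Arguments.
Unset Strict Implicit.
Unset Printing Implicit Defensive.

Lemma closed_loop_expansion (F : comNzRingType) (n m : nat)
    (A C X : 'M[F]_n) (B D : 'M[F]_(n, m)) (K : 'M[F]_(m, n)) :
  X = X^T ->
  let N := X *m B + C^T *m X *m D in
  X *m (A + B *m K) + (A + B *m K)^T *m X
    + (C + D *m K)^T *m X *m (C + D *m K)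
  = (X *m A + A^T *m X + C^T *m X *m C)
    + (N *m K + (N *m K)^T + K^T *m (D^T *m X *m D) *m K).
Proof.
move=> symX /=.
rewrite !(raddfD, trmx_mul) /= !(trmx_mul, mulmxDl, mulmxDr, trmxK) -symX !mulmxA.
(* Regroup the eight terms by their degree in [K]. *)
by rewrite [LHS](AC ((2*2)*(2*2)) ((1*3*5)*((2*7)*(4*6)*8))).
Qed.

Lemma double_eq0 (F : numDomainType) (x : F) : x + x = 0 -> x = 0.
Proof. by move/eqP; rewrite -mulr2n mulrn_eq0 => /eqP. Qed.

Lemma double_mx_eq0 (F : numDomainType) (p q : nat) (M : 'M[F]_(p, q)) :
  M + M = 0 -> M = 0.
Proof.
move=> M0; apply/matrixP=> i j; rewrite mxE; apply: double_eq0.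
by move/matrixP/(_ i j): M0; rewrite !mxE.
Qed.

(** The linear part is odd in [K] and the quadratic part is even, so adding the
    identities for [K] and [- K] leaves twice the quadratic part.  The gains
    range over the image of a ring morphism, which stands for the embedding of
    the reals into the complex numbers. *)
Lemma linear_quadratic_split (R : nzRingType) (F : numDomainType)
    (f : {rmorphism R -> F}) (n m : nat) (N : 'M[F]_(n, m)) (P : 'M[F]_m) :
  (forall K : 'M[R]_(m, n),
     N *m map_mx f K + (N *m map_mx f K)^T
       + (map_mx f K)^T *m P *m map_mx f K = 0) ->
  forall K : 'M[R]_(m, n),
    N *m map_mx f K + (N *m map_mx f K)^T = 0 /\
    (map_mx f K)^T *m P *m map_mx f K = 0.
Proof.
move=> H K; have := H (- K); have := H K.
rewrite map_mxN mulmxN !raddfN /= !mulNmx opprK -opprD.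
set l := N *m _ + _; set q := _ *m P *m _ => HK HNK.
have q0 : q = 0.
  by apply: double_mx_eq0; rewrite -[RHS]addr0 -{1}HK -HNK addrACA subrr add0r.
by split=> //; rewrite -HK q0 addr0.
Qed.

(** At the matrix unit [K = e_j e_i'], column [i] of [N K] is column [j] of [N],
    so the [(i, i)] entry of the hypothesis reads [2 N i j = 0]. *)
Lemma linear_part_eq0 (R : nzRingType) (F : numDomainType)
    (f : {rmorphism R -> F}) (n m : nat) (N : 'M[F]_(n, m)) :
  (forall K : 'M[R]_(m, n), N *m map_mx f K + (N *m map_mx f K)^T = 0) ->
  N = 0.
Proof.
move=> H; apply/matrixP=> i j; rewrite mxE; apply: double_eq0.
have /matrixP/(_ i i) := H (delta_mx j i).
rewrite map_delta_mx !mxE (bigD1 j) //= big1 ?addr0; last first.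
  by move=> k /negPf kj; rewrite mxE kj mulr0.
by rewrite mxE !eqxx mulr1.
Qed.

(** A column index [i] must exist: otherwise [K] has no entries and the
    hypothesis is empty.  Polarizing at the units [e_j e_i'] and [e_k e_i']
    gives a matrix whose [(i, i)] entry is [P j k + P k j]. *)
Lemma quadratic_part_eq0 (R : nzRingType) (F : numDomainType)
    (f : {rmorphism R -> F}) (n m : nat) (i : 'I_n) (P : 'M[F]_m) :
  P = P^T ->
  (forall K : 'M[R]_(m, n), (map_mx f K)^T *m P *m map_mx f K = 0) -> P = 0.
Proof.
move=> symP H; apply/matrixP=> j k; rewrite mxE; apply: double_eq0.
have entry a b :
    ((delta_mx a i : 'M[F]_(m, n))^T *m P *m delta_mx b i) i i = P a b.
  rewrite -[P in LHS]mulmx1 mxE (bigD1 b) //= big1 ?addr0; last first.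
    by move=> c /negPf cb; rewrite [delta_mx b i c i]mxE cb mulr0.
  rewrite [delta_mx b i b i]mxE !eqxx mulr1 mulmx1 mxE.
  rewrite (bigD1 a) //= big1 ?addr0; last first.
    by move=> c /negPf ca; rewrite !mxE ca mul0r.
  by rewrite !mxE !eqxx mul1r.
have /matrixP/(_ i i) := H (delta_mx j i + delta_mx k i).
rewrite map_mxD [(_ + _)^T]raddfD /= !(mulmxDl, mulmxDr) !H add0r addr0.
rewrite !map_delta_mx.
have swap : P k j = P j k by rewrite [in LHS]symP mxE.
by rewrite mxE !entry [RHS]mxE swap.
Qed.

Theorem theorem2 (R : realType) (n m : nat)
    (A C : 'M[R]_n) (B D : 'M[R]_(n, m)) (lambda : R[i]) :
  unremovable_spectrum A B C D lambda <->
  exists X : 'M[R[i]]_n,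
    [/\ X != 0, X = X^T &
        [/\ X *m complexify A + (complexify A)^T *m X
              + (complexify C)^T *m X *m complexify C = lambda *: X,
            X *m complexify B + (complexify C)^T *m X *m complexify D = 0 &
            (complexify D)^T *m X *m complexify D = 0]].
Proof.
split=> -[X [X0 symX HX]]; exists X; split=> //; last first.
  case: HX => E1 N0 P0 K; rewrite /= /complexify !map_mxD !map_mxM.
  rewrite closed_loop_expansion // E1 N0 P0.
  by rewrite mul0mx trmx0 mulmx0 mul0mx !addr0.
have E1 : X *m complexify A + (complexify A)^T *m X
            + (complexify C)^T *m X *m complexify C = lambda *: X.
  by have := HX 0; rewrite /= !mulmx0 !addr0.
set N := X *m complexify B + _; set P := _ *m X *m complexify D.
(* Subtracting the value at [K = 0] leaves the linear and quadratic parts. *)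
have H (K : 'M[R]_(m, n)) :
    N *m complexify K + (N *m complexify K)^T
      + (complexify K)^T *m P *m complexify K = 0.
  apply: (@addrI _ (lambda *: X)); rewrite addr0 -[RHS](HX K) -E1.
  by rewrite /= /complexify !map_mxD !map_mxM closed_loop_expansion.
have split_H := linear_quadratic_split H.
have symP : P = P^T by rewrite /P !trmx_mul trmxK -symX mulmxA.
(* A nonzero [X] forces [0 < n]. *)
have /existsP[i _] : [exists i : 'I_n, true].
  apply: contraNT X0 => /existsPn no_i.
  by apply/eqP/matrixP=> i; have := no_i i.
split=> //.
  by apply: (@linear_part_eq0 _ _ (real_complex R)) => K; case: (split_H K).
apply: (@quadratic_part_eq0 _ _ (real_complex R) _ _ i) => // K.
by case: (split_H K).
Qed.
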